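(* Let $g\ge 1$, $n\ge 0$, $r\ge 0$ be integers with $2n\le g-1$. Let $C$ be the ribbon of genus $g$ on $\mathbb P^1$ determined by $F=\sum_{i=1}^{g-2}F_i t^{-i}$, and identify $\mathrm{Pic}^{2n}(C)$, the set of isomorphism classes of line bundles of degree $2n$ on $C$, with $\mathbb A^g$ by letting a line bundle correspond to the coefficients $(G_1,\dots,G_g)$ of its gluing datum $G=\sum_{j=1}^g G_jt^{-j}$. Let $\mathcal A_F(G)$ be the $(g-n)\times(n+1)$ matrix with entries $$s_{ij}=G_{i+j-1}+(j-1)F_{i+j-2},\qquad 1\le i\le g-n,\ 1\le j\le n+1,$$ where $F_0=F_{g-1}=0$. Then, under this identification, the locus $W^r_{2n}(C)=\{L\in \mathrm{Pic}^{2n}(C) : h^0(C,L)\ge r+1\}$ is the affine algebraic set $$W^r_{2n}(C)=\{(G_1,\dots,G_g)\in\mathbb A^g : \operatorname{rank}\mathcal A_F(G)\le n-r\}.$$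
   Context: Work over an algebraically closed field $k$ of characteristic $0$. A ribbon on $\mathbb P^1$ is a scheme $C$ with an isomorphism $\mathbb P^1\to C_{red}$ such that the ideal sheaf $\mathscr L$ of $\mathbb P^1$ in $C$ satisfies $\mathscr L^2=0$ and is (as a sheaf on $\mathbb P^1$) a line bundle. Its genus is $g=1-\chi(\mathscr O_C)$; equivalently $\mathscr L\cong\mathscr O_{\mathbb P^1}(-g-1)$. Gluing description of ribbons: cover $\mathbb P^1$ by $u_1=\operatorname{Spec}k[s]$, $u_2=\operatorname{Spec}k[t]$ with $s^{-1}=t$ on $u_1\cap u_2$. A genus $g$ ribbon is obtained by gluing $U_1=\operatorname{Spec}k[s,\epsilon]/\epsilon^2$ and $U_2=\operatorname{Spec}k[t,\eta]/\eta^2$ over $u_1\cap u_2$ via $\epsilon=t^{-g-1}\eta$, $s^{-1}=t+F(t)\eta$, where $F$ can be taken of the form $F=\sum_{i=1}^{g-2}F_it^{-i}$, $F_i\in k$; up to isomorphism over $\mathbb P^1$ the ribbon depends only on $F$ up to a nonzero scalar. Line bundles: the degree of a line bundle $L$ on $C$ is $\deg L=\chi(L)-\chi(\mathscr O_C)$; if $L|_{\mathbb P^1}\cong\mathscr O_{\mathbb P^1}(n)$ then $\deg L=2n$. A degree $2n$ line bundle is given by free generators $e_1$ on $U_1$ and $e_2$ on $U_2$ with $e_1=(t+F\eta)^n(1+G\eta)e_2$ on $U_1\cap U_2$, $G\in k[t,t^{-1}]$; isomorphism classes correspond bijectively to classes of $G$ in $k[t,t^{-1}]/(k[t]+t^{-g-1}k[t^{-1}])$,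 so uniquely to $G=\sum_{j=1}^gG_jt^{-j}$, $(G_1,\dots,G_g)\in\mathbb A^g$. *)

(* Defs.v *)
From mathcomp Require Import all_boot all_order all_algebra.
From mathcomp Require Import classical_sets functions.

Set Implicit Arguments.
Unset Strict Implicit.
Unset Printing Implicit Defensive.

Import Order.TTheory GRing.Theory Num.Theory.

Local Open Scope ring_scope.
Local Open Scope classical_set_scope.

(* A ribbon is handled through its two-chart gluing.  The structure sheaf is
   embedded in its stalk k(t)[eta]/eta^2 at the generic point:
   - O(U_1) = k[s,eps]/eps^2 and O(U_2) = k[t,eta]/eta^2 are represented, as
     k-modules, by pairs (a, b) of polynomials standing for a + b eps, resp.
     a + b eta; the componentwise product on pairs is never used, products
     are computed in k(t)[eta]/eta^2 after the (injective) restriction maps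
     [res1] and [res2];
   - O(U_1 /\ U_2) = k[t,t^-1][eta]/eta^2 is the subset [overlap]. *)

Definition ratfun (k : closedFieldType) : fieldType := {fraction {poly k}}.

Definition generic_stalk (k : closedFieldType) : comUnitAlgType (ratfun k) :=
  {poly %/ ('X^2 : {poly (ratfun k)})}.

Definition ratC (k : closedFieldType) (c : k) : ratfun k := tofrac c%:P.

Definition tvar (k : closedFieldType) : ratfun k := tofrac ('X : {poly k}).

Definition eta (k : closedFieldType) : generic_stalk k :=
  in_qpoly ('X^2 : {poly (ratfun k)}) 'X.

(* [tail v] is v_1 t^-1 + ... + v_m t^-m; the paper's v_i is v 0 (i-1). *)
Definition tail (k : closedFieldType) (m : nat) (v : 'rV[k]_m) : ratfun k :=
  \sum_(j < m) ratC (v 0 j) * tvar k ^- j.+1.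

Section Ribbon.
Variables (k : closedFieldType) (g : nat) (F : 'rV[k]_(g - 2)).
Local Notation D := (generic_stalk k).
Local Notation t := (tvar k).
Local Notation cochains := (({poly k} * {poly k}) * ({poly k} * {poly k}))%type.

(* The value of 1/s on the overlap. *)
Definition sinv : D := t%:A + tail F *: eta k.

Definition eps : D := t ^- g.+1 *: eta k.

Definition eval (x : D) (a : {poly k}) : D :=
  (map_poly (fun c : k => (ratC c)%:A : D) a).[x].

Definition res1 (f : {poly k} * {poly k}) : D :=
  eval sinv^-1 f.1 + eval sinv^-1 f.2 * eps.

Definition res2 (f : {poly k} * {poly k}) : D :=
  eval t%:A f.1 + eval t%:A f.2 * eta k.

Definition overlap : set D :=
  [set x | exists f N, x = t ^- N *: res2 f].

(* A line bundle is given by u with e_1 = u e_2, where e_i freely generates it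
   on U_i; u is a unit of the ring of the overlap.  The structure sheaf is
   u = 1. *)
Definition line_bundle : set D :=
  [set u | overlap u /\ exists2 w, overlap w & u * w = 1].

Definition unit1 (f : {poly k} * {poly k}) := exists f', res1 f * res1 f' = 1.
Definition unit2 (f : {poly k} * {poly k}) := exists f', res2 f * res2 f' = 1.

(* Change of generators e_i' = v_i e_i. *)
Definition iso (u u' : D) :=
  exists v1 v2, [/\ unit1 v1, unit2 v2 & u' * res2 v2 = res1 v1 * u].

Definition iso_class (u : D) : set D := [set u' | line_bundle u' /\ iso u u'].

(* The quotient Z / (B `&` Z) of k-vector spaces has dimension d; [act] is the
   action of k on V. *)
Definition quot_dim (V : zmodType) (act : k -> V -> V) (Z B : set V) (d : nat) :=
  exists e : 'I_d -> V,
    [/\ forall i, Z (e i),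
        forall c : 'I_d -> k, B (\sum_i act (c i) (e i)) -> forall i, c i = 0
      & forall x, Z x -> exists c : 'I_d -> k, B (x - \sum_i act (c i) (e i))].

(* Global sections: f_1 e_1 = f_2 e_2 on the overlap. *)
Definition sections (u : D) : set cochains :=
  [set f | res1 f.1 * u = res2 f.2].

Definition coboundaries (u : D) : set D :=
  [set x | exists f : cochains, x = res1 f.1 * u - res2 f.2].

Definition h0 (u : D) (d : nat) :=
  quot_dim (fun (c : k) (f : cochains) => c *: f) (sections u) [set 0] d.

(* Cech cohomology for the affine cover {U_1, U_2}. *)
Definition h1 (u : D) (d : nat) :=
  quot_dim (fun (c : k) (x : D) => ratC c *: x) overlap (coboundaries u) d.

Definition euler_char (u : D) (chi : int) :=
  exists d0 d1, [/\ h0 u d0, h1 u d1 & chi = d0%:Z - d1%:Z].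

Definition degree (u : D) (d : int) :=
  exists chiL chiO, [/\ euler_char u chiL, euler_char 1 chiO & d = chiL - chiO].

Definition Pic (d : int) : set (set D) :=
  [set L | exists u, [/\ line_bundle u, degree u d & L = iso_class u]].

Definition W (r : nat) (d : int) : set (set D) :=
  [set L | Pic d L /\ exists u h, [/\ L u, h0 u h & (r.+1 <= h)%N]].

(* The isomorphism class of the degree 2n bundle with gluing datum
   G_1 t^-1 + ... + G_g t^-g. *)
Definition bundle_of (n : nat) (G : 'rV[k]_g) : set D :=
  iso_class (sinv ^+ n * (1 + tail G *: eta k)).

End Ribbon.

(* The 1-based coefficient v_i, equal to 0 for i outside 1..m; in particular
   F_0 = F_(g-1) = 0. *)
Definition coef1 (k : closedFieldType) (m : nat) (v : 'rV[k]_m) (i : nat) : k :=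
  \sum_(j < m | j.+1 == i) v 0 j.

(* Row i and column j here are row i+1 and column j+1 in 1-based indexing, so
   the entry G_(i+j-1) + (j-1) F_(i+j-2) becomes G_(i+j+1) + j F_(i+j). *)
Definition AF (k : closedFieldType) (g n : nat) (F : 'rV[k]_(g - 2))
    (G : 'rV[k]_g) : 'M[k]_(g - n, n.+1) :=
  \matrix_(i, j) (coef1 G (i + j).+1 + j%:R * coef1 F (i + j)).

(* Main.v *)
Require Import Defs.
From mathcomp Require Import all_boot all_order all_algebra.
From HB Require Import structures.
From mathcomp Require Import boolp classical_sets functions.
From mathcomp Require Import ring zify.

(* In k(t)[eta]/eta^2 write u = U0 + U1 eta for the gluing datum of a line bundle
   L, with U0 = c t^m, so that L restricts to O(m) on P^1.  The Cech complex of L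
   is block triangular, (v1, v2) |-> (T1 v1, R v1 + T2 v2), where T1 and T2 are the
   Cech differentials of O(m) and of O(m-g-1), which have monomial bases for kernel
   and cokernel.  By the snake lemma h^0 and h^1 of L are determined by the rank of
   the connecting map M : H^0(O(m)) -> H^1(O(m-g-1)); hence deg L = 2m, and for
   0 <= m = n <= g one has H^0(O(n-g-1)) = 0 and h^0(L) = n + 1 - rank M.  For the
   bundle with datum G, M sends t^i to the class of t^i G + i t^(i-1) F, that is,
   M is the transpose of A_F(G). *)

Set Implicit Arguments.
Unset Strict Implicit.
Unset Printing Implicit Defensive.

Import Order.TTheory GRing.Theory Num.Theory.
Local Open Scope ring_scope.
Local Open Scope classical_set_scope.

(** * Cohomology of a block triangular two-term complex *)

(** The triangular shape comes from the substitution 1/s = t + F eta. Since eta^2 = 0, a(s) becomes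
    a(1/t) - t^-2 F a'(1/t) eta, so the coefficient of 1 never sees the nilpotent parts, while R
    collects U1 and this derivative. On s^(n-i) the derivative contributes -(n-i) t^(i-1) F and the
    factor (t + F eta)^n contributes n t^(i-1) F; their sum explains the multiplicity i of F. The
    Cech groups are subsets of the generic stalk, on which k acts through [ratC], whereas ranks and
    kernels call for modules over k. Laurent polynomials are therefore modelled by pairs of
    polynomials, the Cech maps are lifted to linear maps between such pairs, and the dimensions are
    transported back. As [h0] and [h1] are relations, the uniqueness of dimensions has to be proved
    too. *)

Definition lincomb (k : pzRingType) (V : lmodType k) d (x : 'I_d -> V)
  (a : 'rV[k]_d) : V := \sum_i a 0 i *: x i.

Section Lincomb.
Variables (k : comPzRingType) (V V' : lmodType k).
Implicit Types (d : nat).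

Lemma lincomb_is_linear d (x : 'I_d -> V) : linear (lincomb x).
Proof.
move=> c a b; rewrite /lincomb scaler_sumr -big_split /=.
by apply: eq_bigr => i _; rewrite !mxE scalerDl scalerA.
Qed.
HB.instance Definition _ d (x : 'I_d -> V) :=
  GRing.isLinear.Build k _ _ _ (lincomb x) (lincomb_is_linear x).

Lemma lincomb_mulmx d d' (x : 'I_d -> V) (M : 'M[k]_(d', d)) a :
  lincomb x (a *m M) = lincomb (fun i => lincomb x (row i M)) a.
Proof.
rewrite /lincomb; under eq_bigr do rewrite mxE scaler_suml.
rewrite exchange_big; apply: eq_bigr => j _; rewrite scaler_sumr.
by apply: eq_bigr => i _; rewrite mxE scalerA.
Qed.

Lemma linear_lincomb d (f : {linear V -> V'}) (x : 'I_d -> V) a :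
  f (lincomb x a) = lincomb (f \o x) a.
Proof. by rewrite /lincomb linear_sum; apply: eq_bigr => i _; rewrite linearZ. Qed.

Lemma lincomb_row_mx d d' (e : 'I_(d + d') -> V) a b :
  lincomb e (row_mx a b) =
  lincomb (e \o lshift d') a + lincomb (e \o @rshift d d') b.
Proof.
rewrite /lincomb big_split_ord /=; congr (_ + _); apply: eq_bigr => i _.
  by rewrite row_mxEl.
by rewrite row_mxEr.
Qed.

Lemma lincomb_pair d (e : 'I_d -> V) (e' : 'I_d -> V') a :
  lincomb (fun i => (e i, e' i) : V * V') a = (lincomb e a, lincomb e' a).
Proof.
by rewrite /lincomb; elim/big_rec3: _ => [|i u v [? ?] _ [-> ->]].
Qed.

Lemma lincomb0 d (a : 'rV[k]_d) : lincomb (fun=> 0 : V) a = 0.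
Proof. by rewrite /lincomb big1 // => i _; rewrite scaler0. Qed.

End Lincomb.

(** * Dimensions of subquotients: row vectors, transport, uniqueness *)

Section QuotDim.
Variable k : closedFieldType.
Implicit Types V : lmodType k.

(** Coefficient families become row vectors, on which matrices and their ranks can act. *)
Lemma quot_dimP V (Z B : set V) d :
  quot_dim ( *:%R ) Z B d <-> exists e : 'I_d -> V,
    [/\ forall i, Z (e i), forall c, B (lincomb e c) -> c = 0
      & forall x, Z x -> exists c, B (x - lincomb e c)].
Proof.
split=> -[e [Ze freee gene]]; exists e; split=> //.
- by move=> c /freee c0; apply/rowP => i; rewrite c0 mxE.
- by move=> x /gene[c Bc]; exists (\row_i c i); rewrite /lincomb;
     under eq_bigr do rewrite mxE.
- move=> c; have -> : \sum_i c i *: e i = lincomb e (\row_i c i).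
    by rewrite /lincomb; under [RHS]eq_bigr do rewrite mxE.
  by move=> /freee /rowP c0 i; have := c0 i; rewrite !mxE.
- by move=> x /gene[c Bc]; exists (c 0).
Qed.

(** The transport principle: [phi] induces an isomorphism of quotients. The actions are kept
    abstract so that the target can be the generic stalk with [ratC] acting. *)
Lemma quot_dim_image (V V' : zmodType) (act : k -> V -> V) (act' : k -> V' -> V')
    (phi : V -> V') (Z B : set V) (Z' B' : set V') d :
    {morph phi : x y / x + y} ->
    (forall c, {morph phi : x / act c x >-> act' c x}) ->
    (forall x, Z x -> Z' (phi x)) -> (forall y, Z' y -> exists2 x, Z x & y = phi x) ->
    (forall x, B' (phi x) <-> B x) ->
  quot_dim act Z B d -> quot_dim act' Z' B' d.
Proof.
move=> phiD phiZ ZZ' Z'Z B'B [e [Ze freee gene]].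
have phi0 : phi 0 = 0 by apply: (addrI (phi 0)); rewrite -phiD !addr0.
have phiN x : phi (- x) = - phi x.
  by apply/eqP; rewrite -addr_eq0 -phiD addNr phi0.
have phiS c : phi (\sum_i act (c i) (e i)) = \sum_i act' (c i) (phi (e i)).
  by rewrite (big_morph phi phiD phi0); under eq_bigr do rewrite phiZ.
exists (phi \o e); split=> [i|c|_ /Z'Z[x Zx ->]]; first exact: ZZ'.
  by rewrite /= -phiS B'B => /freee.
have [c Bc] := gene x Zx; exists c.
by rewrite /= -phiS -phiN -phiD B'B.
Qed.

(** Exchange argument: writing [e] in terms of [e'] modulo [B] gives a d x d' matrix, and if d' < d
    a nonzero vector of its left kernel is a forbidden relation among the [e i]. *)
Lemma quot_dim_le (V : zmodType) (act : k -> V -> V) (Z B : set V) d d' :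
    (forall c x y, act c (x - y) = act c x - act c y) ->
    (forall c c' x, act (c + c') x = act c x + act c' x) ->
    (forall c c' x, act (c * c') x = act c (act c' x)) ->
    (forall c x, B x -> B (act c x)) ->
    (forall x y, B x -> B y -> B (x + y)) -> B 0 ->
  quot_dim act Z B d -> quot_dim act Z B d' -> (d <= d')%N.
Proof.
move=> actB actD actM BZ BD B0 [e [Ze freee _]] [e' [_ _ gene']].
have act0 c : act c 0 = 0 by rewrite -{1}(subrr 0) actB subrr.
have actN c x : act c (- x) = - act c x by rewrite -sub0r actB act0 sub0r.
have actDr c x y : act c (x + y) = act c x + act c y.
  by rewrite -{1}[y]opprK actB actN opprK.
have act0l x : act 0 x = 0 by apply: (addrI (act 0 x)); rewrite -actD !addr0.
have [M BM] := choice (fun i => gene' _ (Ze i)).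
rewrite leqNgt; apply/negP => lt_d'd.
pose N : 'M[k]_(d, d') := \matrix_(i, j) M i j.
have : kermx N != 0.
  rewrite -mxrank_eq0 mxrank_ker subn_eq0 -ltnNge.
  exact: leq_ltn_trans (rank_leq_col N) lt_d'd.
move=> /rowV0Pn[c /sub_kermxP cN0 /eqP[]].
apply/rowP => i; rewrite mxE; apply: freee => {i}.
(* Each difference lies in [B], and the subtracted terms cancel in total because [c] kills the
   matrix [N]. *)
suff -> : \sum_i act (c 0 i) (e i) =
    \sum_i act (c 0 i) (e i - \sum_j act (M i j) (e' j)).
  by elim/big_ind: _ => // i _; apply: BZ.
apply/eqP; rewrite -subr_eq0 -sumrB.
under eq_bigr do rewrite actB opprB addrCA subrr addr0.
under eq_bigr do rewrite (big_morph (act _) (actDr _) (act0 _)).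
rewrite exchange_big big1 //= => j _.
under eq_bigr do rewrite -actM.
rewrite -(big_morph (act^~ (e' j)) (fun c c' => actD c c' (e' j)) (act0l _)).
have /rowP/(_ j) := cN0; rewrite !mxE => cNj.
have -> : \sum_i c 0 i * M i j = 0.
  by rewrite -[RHS]cNj; apply: eq_bigr => i _; rewrite mxE.
exact: act0l.
Qed.

Lemma quot_dim_uniq (V : zmodType) (act : k -> V -> V) (Z B : set V) d d' :
    (forall c x y, act c (x - y) = act c x - act c y) ->
    (forall c c' x, act (c + c') x = act c x + act c' x) ->
    (forall c c' x, act (c * c') x = act c (act c' x)) ->
    (forall c x, B x -> B (act c x)) ->
    (forall x y, B x -> B y -> B (x + y)) -> B 0 ->
  quot_dim act Z B d -> quot_dim act Z B d' -> d = d'.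
Proof.
move=> actB actD actM BZ BD B0 Zd Zd'; apply/eqP; rewrite eqn_leq.
apply/andP; split.
  exact: quot_dim_le actB actD actM BZ BD B0 Zd Zd'.
exact: quot_dim_le actB actD actM BZ BD B0 Zd' Zd.
Qed.

(* The data of [quot_dim] for the kernel and for the cokernel of [T], with the
   bases made explicit. *)
Definition ker_basis V (W : lmodType k) (T : V -> W) d (x : 'I_d -> V) :=
  [/\ forall i, T (x i) = 0, injective (lincomb x)
    & forall v, T v = 0 -> exists a, v = lincomb x a].

Definition coker_basis (V W : lmodType k) (T : V -> W) d (y : 'I_d -> W) :=
  (forall a v, lincomb y a = T v -> a = 0) /\
  (forall w, exists a v, w = lincomb y a + T v).

End QuotDim.

Section Snake.
Variables (k : closedFieldType) (V1 V2 W1 W2 : lmodType k).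
Variables (T1 : {linear V1 -> W1}) (T2 : {linear V2 -> W2}) (R : {linear V1 -> W2}).
Variables (p1 q1 p2 q2 : nat) (x : 'I_p1 -> V1) (z : 'I_p2 -> V2).
Variables (y : 'I_q1 -> W1) (w : 'I_q2 -> W2) (M : 'M[k]_(p1, q2)).
Hypotheses (kerx : ker_basis T1 x) (kerz : ker_basis T2 z).
Hypotheses (cokery : coker_basis T1 y) (cokerw : coker_basis T2 w).
Hypothesis connecting : forall i, exists v, R (x i) = lincomb w (row i M) + T2 v.

Definition triangular (v : V1 * V2) : W1 * W2 := (T1 v.1, R v.1 + T2 v.2).

Lemma connecting_lincomb a : exists v, R (lincomb x a) = lincomb w (a *m M) + T2 v.
Proof.
have [v Rx] := choice connecting; exists (lincomb v a).
rewrite lincomb_mulmx !linear_lincomb /lincomb -big_split /=.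
by apply: eq_bigr => i _; rewrite Rx scalerDr.
Qed.

(** The kernel is an extension of the kernel of [M] by that of [T2]: a cycle of [T1] lifts exactly
    when its image under [R] vanishes modulo [T2]. *)
Lemma triangular_ker : quot_dim ( *:%R ) [set v | triangular v = 0] [set 0]
  (p2 + (p1 - \rank M)).
Proof.
have [T1x xinj xgen] := kerx; have [T2z zinj zgen] := kerz.
have [wfree _] := cokerw.
rewrite -mxrank_ker; apply/quot_dimP.
pose K := row_base (kermx M).
have KM : K *m M = 0 by apply/sub_kermxP; rewrite eq_row_base.
have T1lin a : T1 (lincomb x a) = 0.
  by rewrite linear_lincomb /lincomb big1 // => i _; rewrite /= T1x scaler0.
have [v vK] : {v : 'I_(\rank (kermx M)) -> V2 & forall l,
    R (lincomb x (row l K)) + T2 (v l) = 0}.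
  apply: (@choice _ _ (fun l v => R (lincomb x (row l K)) + T2 v = 0)) => l.
  have [u ->] := connecting_lincomb (row l K); exists (- u).
  by rewrite -row_mul KM linear0 linear0 add0r linearN subrr.
(* Basis: the kernel of [T2], then one lift of each vector in a basis of the kernel of [M]. *)
pose e (i : 'I_(p2 + \rank (kermx M))) : V1 * V2 := match fintype.split i with
  inl i => (0, z i) | inr l => (lincomb x (row l K), v l) end.
have eE a b : lincomb e (row_mx a b) =
    (lincomb x (b *m K), lincomb z a + lincomb v b).
  rewrite lincomb_row_mx.
  have -> : e \o lshift _ = fun i => (0, z i).
    by apply/funext => i; rewrite /e /= (unsplitK (inl i)).
  have -> : e \o @rshift _ _ = fun l => (lincomb x (row l K), v l).
    by apply/funext => i; rewrite /e /= (unsplitK (inr i)).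
  by rewrite !lincomb_pair lincomb0 lincomb_mulmx /= -[LHS]/(_, _) /= add0r.
exists e; split.
- move=> i; rewrite /= /triangular /e; case: fintype.split => j /=.
    by rewrite !linear0 add0r T2z.
  by rewrite T1lin vK.
- move=> c; rewrite -[c]hsubmxK eE => -[xb zav].
  have b0 : rsubmx c = 0.
    have /xinj bK0 : lincomb x (rsubmx c *m K) = lincomb x 0 by rewrite linear0.
    by apply: (row_free_inj (row_base_free (kermx M))); rewrite bK0 mul0mx.
  have a0 : lsubmx c = 0 by apply: zinj; rewrite linear0 -zav b0 linear0 addr0.
  by rewrite a0 b0 row_mx0.
- move=> [v1 v2] [] /= /xgen[a ->] Rv.
  have [u Ru] := connecting_lincomb a.
  (* [R v1] lies in the image of [T2], and the [w] are independent modulo that image. *)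
  have aM : a *m M = 0.
    apply: (wfree _ (- (v2 + u))); rewrite linearN linearD; apply/eqP.
    by rewrite -addr_eq0 addrCA addrA addrAC addrC addrCA -Ru addrC Rv.
  have /submxP[b ab] : (a <= K)%MS by rewrite eq_row_base; apply/sub_kermxP.
  have /zgen[c vc] : T2 (v2 - lincomb v b) = 0.
    rewrite linearB [T2 (lincomb _ _)]linear_lincomb.
    have -> : lincomb (T2 \o v) b = - R (lincomb x a).
      rewrite ab lincomb_mulmx linear_lincomb /lincomb -sumrN.
      apply: eq_bigr => l _; rewrite -scalerN /=; congr (_ *: _).
      by apply/eqP; rewrite -addr_eq0 addrC vK.
    by rewrite opprK addrC.
  exists (row_mx c b); rewrite eE -ab -vc subrK.
  by apply/eqP; rewrite subr_eq0.
Qed.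

(** The cokernel is an extension of that of [T1] by that of [M]; a complement of the row space of
    [M] supplies representatives for the latter. *)
Lemma triangular_coker :
  quot_dim ( *:%R ) setT [set triangular v | v in setT] (q1 + (q2 - \rank M)).
Proof.
have [T1x xinj xgen] := kerx.
have [yfree ygen] := cokery; have [wfree wgen] := cokerw.
rewrite -mxrank_compl; apply/quot_dimP.
pose C := row_base (M^C)%MS.
have T1lin a : T1 (lincomb x a) = 0.
  by rewrite linear_lincomb /lincomb big1 // => i _; rewrite /= T1x scaler0.
pose e (i : 'I_(q1 + \rank (M^C)%MS)) : W1 * W2 := match fintype.split i with
  inl i => (y i, 0) | inr l => (0, lincomb w (row l C)) end.
have eE a b : lincomb e (row_mx a b) = (lincomb y a, lincomb w (b *m C)).
  rewrite lincomb_row_mx.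
  have -> : e \o lshift _ = fun i => (y i, 0).
    by apply/funext => i; rewrite /e /= (unsplitK (inl i)).
  have -> : e \o @rshift _ _ = fun l => (0, lincomb w (row l C)).
    by apply/funext => i; rewrite /e /= (unsplitK (inr i)).
  rewrite !lincomb_pair !lincomb0 lincomb_mulmx /= -[LHS]/(_, _) /=.
  by rewrite add0r addr0.
exists e; split=> //.
- move=> c [[v1 v2] _]; rewrite -[c]hsubmxK eE /triangular /= => -[T1v Rv].
  have a0 : lsubmx c = 0 by apply: yfree (esym T1v).
  have /xgen[a v1a] : T1 v1 = 0 by rewrite T1v a0 linear0.
  have [u Ru] := connecting_lincomb a.
  have caM : rsubmx c *m C = a *m M.
    apply/eqP; rewrite -subr_eq0; apply/eqP/(wfree _ (u + v2)).
    by rewrite linearB /= -Rv v1a Ru linearD /= addrC addrA addrA addNr add0r.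
  (* By [caM] this vector lies both in the row space of [M] and in its complement. *)
  have cC0 : rsubmx c *m C = 0.
    apply/eqP; rewrite -submx0 -(capmx_compl M) sub_capmx {1}caM submxMl.
    by rewrite (submx_trans (submxMl _ _)) // eq_row_base.
  have b0 : rsubmx c = 0.
    by apply: (row_free_inj (row_base_free (M^C)%MS)); rewrite cC0 mul0mx.
  by rewrite a0 b0 row_mx0.
- move=> [w1 w2] _; have [a [v1 ->]] := ygen w1.
  have [b [v2 w2E]] := wgen (w2 - R v1).
  have : (b <= M + C)%MS.
    rewrite (adds_eqmx (eqmx_refl M) (eq_row_base _)).
    by rewrite submx_full ?addsmx_compl_full.
  move=> /sub_addsmxP[[c d] /= bE].
  (* The part of [b] in the row space of [M] is absorbed by adding a cycle of [T1] to [v1], which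
     leaves the first component unchanged. *)
  have [u Ru] := connecting_lincomb c.
  exists (row_mx a d), (v1 + lincomb x c, v2 - u) => //.
  rewrite eE /triangular /= -[RHS]/(_ - _, _ - _) /= linearD T1lin addr0.
  congr (_, _); first by rewrite addrC addKr.
  have -> : w2 = R v1 + lincomb w b + T2 v2 by rewrite -addrA -w2E addrC subrK.
  rewrite bE linearB !linearD /= Ru [X in _ = X]addrAC.
  by rewrite [X in _ + X = _]addrC !addrA !addrK.
Qed.

End Snake.

(** * Laurent polynomials *)

HB.instance Definition _ (k : closedFieldType) := GRing.RMorphism.copy (@ratC k)
  (@FracField.tofrac {poly k} \o polyC).

(* Locked, since unification otherwise unfolds it down to fractions. *)
HB.lock Definition ev (k : closedFieldType) (x : ratfun k) (a : {poly k}) :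
  ratfun k := (map_poly (@ratC k) a).[x].

Section Laurent.
Variable k : closedFieldType.
Local Notation K := (ratfun k).
Local Notation t := (tvar k).
Implicit Types (x y : K) (a b p q : {poly k}).

Lemma ev_is_zmod_morphism x : zmod_morphism (ev x).
Proof. by move=> a b; rewrite ev.unlock rmorphB hornerD hornerN. Qed.
HB.instance Definition _ x :=
  GRing.isZmodMorphism.Build _ _ (ev x) (ev_is_zmod_morphism x).

Lemma ev_is_monoid_morphism x : monoid_morphism (ev x).
Proof. by split=> [|a b]; rewrite ev.unlock ?rmorph1 ?hornerC // rmorphM hornerM. Qed.
HB.instance Definition _ x :=
  GRing.isMonoidMorphism.Build _ _ (ev x) (ev_is_monoid_morphism x).

Lemma evC x c : ev x c%:P = ratC c.
Proof. by rewrite ev.unlock map_polyC hornerC. Qed.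
Lemma evX x : ev x 'X = x.
Proof. by rewrite ev.unlock map_polyX hornerX. Qed.
Lemma evXn x n : ev x 'X^n = x ^+ n.
Proof. by rewrite rmorphXn /= evX. Qed.
Lemma evZ x c a : ev x (c *: a) = ratC c * ev x a.
Proof. by rewrite -mul_polyC rmorphM /= evC. Qed.

Lemma ev_cons x a c : ev x (a * 'X + c%:P) = x * ev x a + ratC c.
Proof. by rewrite rmorphD rmorphM /= evX evC mulrC. Qed.

Lemma ratC_eq0 (c : k) : (ratC c == 0) = (c == 0).
Proof. by rewrite /ratC tofrac_eq0 polyC_eq0. Qed.

Lemma tvar_neq0 : t != 0.
Proof. by rewrite tofrac_eq0 polyX_eq0. Qed.
Let t0 := tvar_neq0.

Lemma tvarX_neq0 n : t ^+ n != 0.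
Proof. exact: expf_neq0 tvar_neq0. Qed.

Lemma ev_tvar a : ev t a = tofrac a.
Proof.
elim/poly_ind: a => [|a c IH]; first by rewrite !rmorph0.
by rewrite rmorphD rmorphM /= IH evX evC [RHS]rmorphD rmorphM.
Qed.

Lemma ev_tvar_inj : injective (ev t).
Proof. by move=> a b; rewrite !ev_tvar => /eqP; rewrite tofrac_eq => /eqP. Qed.

Lemma exprB_tvar m n : (n <= m)%N -> t ^+ (m - n) = t ^+ m * t ^- n.
Proof. by move=> le_nm; rewrite expfB_cond ?(negPf t0). Qed.

(** Clearing denominators reverses the coefficients, which reduces questions on t^-1 k[t^-1] to
    polynomials in t. *)
Lemma ev_tvarV n a : (size a <= n)%N ->
  t ^+ n * (t^-1 * ev t^-1 a) = ev t (\poly_(i < n) a`_(n.-1 - i)).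
Proof.
move=> le_an; rewrite poly_def rmorph_sum /=.
have {1}-> : a = \sum_(i < n) a`_i *: 'X^i.
  by rewrite -poly_def; apply/polyP => i; rewrite coef_poly; case: ltnP => // ni;
     rewrite nth_default // (leq_trans le_an).
rewrite rmorph_sum !mulr_sumr (reindex_inj rev_ord_inj) /=.
apply: eq_bigr => i _; rewrite !evZ !evXn.
have n0 : (0 < n)%N by exact: leq_ltn_trans (ltn_ord i).
have in1 : (i <= n.-1)%N by rewrite -ltnS prednK.
rewrite (_ : (n - i.+1 = n.-1 - i)%N); last by rewrite -{1}(prednK n0).
rewrite (mulrCA t^-1) (mulrCA (t ^+ n)); congr (_ * _).
rewrite -exprS exprVn (_ : (n.-1 - i).+1 = (n - i)%N); last by lia.
by rewrite -exprB_tvar ?leq_subr // subKn // ltnW.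
Qed.

(* Models k[t,t^-1] as k[t] + t^-1 k[t^-1], where kernels and cokernels of Cech
   differentials can be read off. *)
Definition laurent_of (w : {poly k} * {poly k}) : K :=
  ev t w.1 + t^-1 * ev t^-1 w.2.

Lemma laurent_of_is_zmod_morphism : zmod_morphism laurent_of.
Proof. by move=> v w; rewrite /laurent_of /= !rmorphB /= mulrBr opprD addrACA. Qed.
HB.instance Definition _ :=
  GRing.isZmodMorphism.Build _ _ laurent_of laurent_of_is_zmod_morphism.

Lemma laurent_ofZ c w : laurent_of (c *: w) = ratC c * laurent_of w.
Proof. by rewrite /laurent_of /= !evZ mulrDr mulrCA. Qed.

(** After multiplication by t^(size q), the reversed [q] occupies the degrees below size q and [p]
    those from size q on, so nothing can cancel. *)
Lemma laurent_of_inj : injective laurent_of.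
Proof.
apply: raddf_inj => -[p q] /= pq0.
have : t ^+ (size q) * (ev t p + t^-1 * ev t^-1 q) = 0.
  by rewrite -[_ + _]/(laurent_of (p, q)) pq0 mulr0.
rewrite mulrDr ev_tvarV // -evXn -rmorphM -rmorphD /= -(rmorph0 (ev t)).
move/ev_tvar_inj => /polyP pqE.
have q0 : q = 0.
  apply/polyP => i; rewrite coef0.
  case: (ltnP i (size q)) => [lt_iq|/(nth_default 0)//].
  have := pqE ((size q).-1 - i)%N; rewrite coefD coefXnM coef_poly coef0.
  case: (size q) lt_iq => // m lt_im /=.
  by rewrite !ltnS leq_subr add0r subKn.
congr (_, _) => //; apply/polyP => i; have := pqE i.
by rewrite q0 size_poly0 coefD coefXnM subn0 coef_poly !coef0 /= addr0.
Qed.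

Definition laurent : set K := range laurent_of.

Lemma laurentZ c x : laurent x -> laurent (ratC c * x).
Proof. by move=> [w _ <-]; exists (c *: w); rewrite ?laurent_ofZ. Qed.
Lemma laurentD x y : laurent x -> laurent y -> laurent (x + y).
Proof. by move=> [v _ <-] [w _ <-]; exists (v + w); rewrite ?raddfD. Qed.
Lemma laurentN x : laurent x -> laurent (- x).
Proof. by move=> [v _ <-]; exists (- v); rewrite ?raddfN. Qed.
Lemma laurentB x y : laurent x -> laurent y -> laurent (x - y).
Proof. by move=> Lx /laurentN; apply: laurentD. Qed.
Lemma laurent_tvarM x : laurent x -> laurent (t * x).
Proof.
move=> [[p q] _ <-]; rewrite /laurent_of /=; elim/poly_ind: q => [|q c _].
  exists (p * 'X, 0); rewrite // /laurent_of /= !rmorph0 !mulr0 !addr0.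
  by rewrite rmorphM /= evX mulrC.
exists (p * 'X + c%:P, q); rewrite // /laurent_of /= !rmorphD !rmorphM /= !evC !evX.
by rewrite mulrDr mulVKf // mulrC -addrA [ratC c + _]addrC [t^-1 * _]mulrC.
Qed.
Lemma laurent_tvarVM x : laurent x -> laurent (t^-1 * x).
Proof.
move=> [[p q] _ <-]; rewrite /laurent_of /=; elim/poly_ind: p => [|p c _].
  exists (0, q * 'X); rewrite // /laurent_of /= !rmorph0 !add0r.
  by rewrite rmorphM /= evX [_ * t^-1]mulrC.
exists (p, q * 'X + c%:P); rewrite // /laurent_of /= !rmorphD !rmorphM /= !evC !evX.
rewrite -addrA [RHS]mulrDr [_ * t]mulrC mulKf //; congr (_ + t^-1 * _).
by rewrite addrC [t^-1 * _]mulrC.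
Qed.
Lemma laurent_tvarXM n x : laurent x -> laurent (t ^+ n * x).
Proof.
move=> Lx; elim: n => [|n IH]; first by rewrite mul1r.
by rewrite exprS -mulrA; apply: laurent_tvarM.
Qed.
Lemma laurent_tvarXVM n x : laurent x -> laurent (t ^- n * x).
Proof.
move=> Lx; elim: n => [|n IH]; first by rewrite invr1 mul1r.
by rewrite exprS invfM -mulrA; apply: laurent_tvarVM.
Qed.
Lemma laurent_ev x a : laurent x -> laurent (ev t a * x).
Proof.
move=> Lx; elim/poly_ind: a => [|a c IH].
  by rewrite rmorph0 mul0r; exists 0; rewrite ?raddf0.
rewrite ev_cons mulrDl -mulrA.
by apply: laurentD; [apply: laurent_tvarM|apply: laurentZ].
Qed.
Lemma laurent_evV x a : laurent x -> laurent (ev t^-1 a * x).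
Proof.
move=> Lx; elim/poly_ind: a => [|a c IH].
  by rewrite rmorph0 mul0r; exists 0; rewrite ?raddf0.
rewrite ev_cons mulrDl -mulrA.
by apply: laurentD; [apply: laurent_tvarVM|apply: laurentZ].
Qed.
Lemma laurent1 : laurent 1.
Proof. by exists (1, 0); rewrite // /laurent_of /= rmorph1 rmorph0 mulr0 addr0. Qed.
Lemma laurentM x y : laurent x -> laurent y -> laurent (x * y).
Proof.
move=> [v _ <-] Ly; rewrite /laurent_of mulrDl -mulrA.
by apply: laurentD; [apply: laurent_ev|apply/laurent_tvarVM/laurent_evV].
Qed.

Lemma laurent_monomial (c : k) (m : int) : laurent (ratC c * t ^ m).
Proof.
apply: laurentZ; rewrite -[_ ^ _]mulr1.
by case: m => m; [apply: laurent_tvarXM|apply: laurent_tvarXVM]; apply: laurent1.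
Qed.

Lemma laurentP x : laurent x <-> exists N p, x = t ^- N * ev t p.
Proof.
split=> [[[p q] _ <-]|[N [p ->]]]; last first.
  by rewrite -[ev _ _]mulr1; apply/laurent_tvarXVM/laurent_ev/laurent1.
exists (size q), ('X^(size q) * p + \poly_(i < size q) q`_((size q).-1 - i)).
by rewrite rmorphD rmorphM /= evXn -ev_tvarV // -mulrDr mulKf ?tvarX_neq0.
Qed.

End Laurent.

(* Multiplication by U glues O(m) from its two charts when U = c t^m. *)
Section GluingMap.
Variable k : closedFieldType.
Local Notation K := (ratfun k).
Local Notation t := (tvar k).
Local Notation W := ({poly k} * {poly k})%type.

(** The lift is chosen pointwise; injectivity of [laurent_of] forces it to be linear. This is how
    Cech maps become linear maps over k. *)
Lemma laurent_lift (V : lmodType k) (f : V -> K) :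
    (forall c u v, f (c *: u + v) = ratC c * f u + f v) ->
    (forall v, laurent (f v)) ->
  exists T : {linear V -> W}, forall v, laurent_of (T v) = f v.
Proof.
move=> flin fL.
have [T TE] : {T : V -> W & forall v, laurent_of (T v) = f v}.
  apply: (@choice _ _ (fun v w => laurent_of w = f v)) => v.
  by have [w _ wE] := fL v; exists w.
have Tlin : linear T.
  move=> c u v; apply: laurent_of_inj.
  by rewrite raddfD /= laurent_ofZ !TE flin.
pose Tmix := GRing.isLinear.Build k V W _ T Tlin.
by exists (HB.pack T Tmix : {linear V -> W}).
Qed.

Lemma lincomb_polyX n (a : 'rV[k]_n) :
  lincomb (fun i : 'I_n => 'X^i : {poly k}) a = rVpoly a.
Proof.
apply/polyP => i; rewrite coef_sum coef_rVpoly.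
case: insubP => [j _ <-|]; last first.
  rewrite -leqNgt => le_ni; rewrite big1 // => j _.
  by rewrite coefZ coefXn gtn_eqF ?mulr0 // (leq_trans (ltn_ord j)).
rewrite (bigD1 j) //= coefZ coefXn eqxx mulr1 big1 ?addr0 // => l ne_lj.
by rewrite coefZ coefXn eq_sym (inj_eq val_inj) (negPf ne_lj) mulr0.
Qed.

Lemma rVpoly_inj n : injective (@rVpoly k n).
Proof. exact: can_inj rVpolyK. Qed.

Lemma rVpoly_eq0 n (a : 'rV[k]_n) b : rVpoly a = 'X^n * b -> a = 0.
Proof.
move=> ab; apply: rVpoly_inj; rewrite linear0; apply/polyP => i.
case: (ltnP i n) => [lt_in|le_ni]; first by rewrite ab coefXnM lt_in coef0.
by rewrite coef0 nth_default // (leq_trans (size_poly _ _)).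
Qed.

Lemma poly_split n (p : {poly k}) :
  p = rVpoly (poly_rV (take_poly n p) : 'rV_n) + 'X^n * drop_poly n p.
Proof. by rewrite poly_rV_K ?size_take_poly // mulrC poly_take_drop. Qed.

Variables (U : K) (T : {linear W -> W}) (c : k).
Hypothesis TE : forall v, laurent_of (T v) = U * ev t^-1 v.1 - ev t v.2.
Hypothesis c_neq0 : c != 0.

Section Nonneg.
Variable p : nat.
Hypothesis Up : t * U = ratC c * t ^+ p.

(** The pairs (s^(p-1-i), c t^i), sections of O(p-1). With the hypothesis on t * U rather than U,
    [p] counts the sections and p = 0 covers O(-1). *)
Definition monomial_sections (i : 'I_p) : W := ('X^(p.-1 - i), c *: 'X^i).

(** On cochains whose s-part is divisible by s^p the differential is a bijection: no cohomology
    arises beyond the monomials of degree below p. *)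
Let T_tail b b' : T ('X^p * b, b') = (- b', c *: b).
Proof.
apply: laurent_of_inj; rewrite TE /laurent_of /= rmorphM /= evXn.
apply: (mulfI (tvar_neq0 k)); rewrite mulrBr [t * (U * _)]mulrA Up.
rewrite mulrDr rmorphN mulrN addrC.
rewrite evZ [t * (t^-1 * _)]mulVKf ?tvar_neq0 // exprVn -mulrA; congr (_ + _ * _).
by rewrite mulVKf ?tvarX_neq0.
Qed.

Lemma T_monomial_sections i : T (monomial_sections i) = 0.
Proof.
apply: laurent_of_inj; rewrite TE raddf0 /= evZ !evXn.
apply: (mulfI (tvar_neq0 k)); rewrite mulrBr [t * (U * _)]mulrA Up mulr0.
apply/eqP; rewrite subr_eq0 -mulrA (mulrCA t); apply/eqP; congr (_ * _).
have p0 : (0 < p)%N by exact: leq_ltn_trans (ltn_ord i).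
have le_ip : (i <= p.-1)%N by rewrite -ltnS prednK.
rewrite exprVn -exprB_tvar; last by rewrite (leq_trans (leq_subr _ _)) ?leq_pred.
by rewrite -exprS; congr (_ ^+ _); lia.
Qed.

Lemma monomial_sections_basis :
  ker_basis T monomial_sections /\ coker_basis T (fun _ : 'I_0 => 0).
Proof.
have linE a : (lincomb monomial_sections a).2 = c *: rVpoly a.
  rewrite -lincomb_polyX /monomial_sections lincomb_pair /= /lincomb scaler_sumr.
  by apply: eq_bigr => i _; rewrite !scalerA mulrC.
split; last first.
  split=> [a _ _|[p' q]]; first exact: thinmx0.
  exists 0, ('X^p * (c^-1 *: q), - p').
  by rewrite T_tail linear0 add0r opprK scalerA divff // scale1r.
split; [exact: T_monomial_sections|move=> a b /(congr1 snd)|].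
  by rewrite !linE => /(scalerI c_neq0)/rVpoly_inj.
move=> [a b] Tab.
(* Coefficients of [a] below degree p, in the reversed order of the sections; what remains of [a] is
   divisible by X^p and [T_tail] applies. *)
pose d : 'rV[k]_p := \row_i a`_(p.-1 - i); exists d.
have [a' aE] : exists a', a - (lincomb monomial_sections d).1 = 'X^p * a'.
  exists (drop_poly p a).
  rewrite {1}(poly_split p a) addrAC -[RHS]add0r; congr (_ + _).
  rewrite -lincomb_polyX /monomial_sections lincomb_pair /= /lincomb.
  rewrite [X in _ - X](reindex_inj rev_ord_inj) -sumrB big1 // => i _ /=.
  have ip := ltn_ord i; have sub_i : (p.-1 - (p - i.+1) = i)%N by lia.
  by rewrite !mxE /= sub_i coef_take_poly ltn_ord subrr.
have : T ((a, b) - lincomb monomial_sections d) = 0.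
  rewrite linearB Tab linear_lincomb /lincomb big1 ?subrr // => i _ /=.
  by rewrite T_monomial_sections scaler0.
rewrite [lincomb _ _]surjective_pairing -[_ - _]/(_ - _, _ - _) aE T_tail.
move=> [/eqP]; rewrite oppr_eq0 => /eqP b0 /eqP.
rewrite scaler_eq0 (negPf c_neq0) => /eqP a'0.
apply/eqP; rewrite -subr_eq0 [lincomb _ _]surjective_pairing.
by rewrite -[_ - _]/(_ - _, _ - _) aE a'0 mulr0 b0.
Qed.

End Nonneg.

Section Negative.
Variable q : nat.
Hypothesis Uq : t * U = ratC c * t ^- q.

(** The pair (0, X^l) stands for t^-(l+1), so these are t^-1, ..., t^-q, a basis of H^1(O(-q-1)). *)
Definition monomial_classes (l : 'I_q) : W := (0, 'X^l).

(** The image is thus k[t] + t^(-q-1) k[t^-1], and the map is visibly injective. *)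
Lemma gluing_negE b b' : T (b, b') = (- b', c *: ('X^q * b)).
Proof.
apply: laurent_of_inj; rewrite TE /laurent_of /= evZ rmorphM /= evXn.
apply: (mulfI (tvar_neq0 k)); rewrite mulrBr [t * (U * _)]mulrA Uq.
rewrite mulrDr rmorphN mulrN addrC.
by rewrite mulVKf ?tvar_neq0 // exprVn mulrA.
Qed.

Lemma monomial_classes_basis :
  ker_basis T (fun _ : 'I_0 => 0) /\ coker_basis T monomial_classes.
Proof.
have linE a : lincomb monomial_classes a = (0, rVpoly a).
  by rewrite /monomial_classes lincomb_pair lincomb0 lincomb_polyX.
split.
  split=> [i|a b _|[a b]]; first exact: linear0.
    by rewrite [a]thinmx0 [b]thinmx0.
  rewrite gluing_negE => -[/eqP + /eqP].
  rewrite oppr_eq0 scaler_eq0 (negPf c_neq0) mulf_eq0 expf_eq0 polyX_eq0 andbF /=.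
  by move=> /eqP-> /eqP->; exists 0; rewrite linear0.
split=> [a [v1 v2]|[p r]]; rewrite ?linE.
  by rewrite gluing_negE => -[_]; rewrite scalerAr => /rVpoly_eq0.
exists (poly_rV (take_poly q r)), (c^-1 *: drop_poly q r, - p).
rewrite gluing_negE linE opprK -scalerAr scalerA divff // scale1r.
by rewrite -[RHS]/(_ + _, _ + _) add0r -poly_split.
Qed.

End Negative.
End GluingMap.

(** * Restriction maps in coordinates *)

Section DualNumbers.
Variable k : closedFieldType.
Local Notation K := (ratfun k).
Local Notation D := (generic_stalk k).
Local Notation t := (tvar k).
Implicit Types x y : K.

Fact dual_key : unit. Proof. by []. Qed.
Definition dual x y : D := locked_with dual_key (x%:A + y *: Defs.eta k).

Lemma dualE x y : x%:A + y *: Defs.eta k = dual x y.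
Proof. by rewrite [RHS]unlock. Qed.

Lemma mk_monicX2 : mk_monic ('X^2 : {poly K}) = 'X^2.
Proof. exact: mk_monic_Xn. Qed.

Lemma val_eta : \val (Defs.eta k) = 'X :> {poly K}.
Proof. by apply: in_qpoly_small; rewrite mk_monicX2 size_polyXn size_polyX. Qed.

Lemma val_dual x y : \val (dual x y) = x%:P + y *: 'X :> {poly K}.
Proof.
rewrite -dualE -[LHS]/(x *: (1 : {poly K}) + y *: \val (Defs.eta k)).
by rewrite val_eta alg_polyC.
Qed.

Lemma dual_inj x y x' y' : dual x y = dual x' y' -> x = x' /\ y = y'.
Proof.
move=> /(congr1 \val); rewrite !val_dual => /polyP xyE.
have := xyE 0; have := xyE 1.
by rewrite !coefE /= !mulr0 !mulr1 !addr0 !add0r.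
Qed.

Lemma dual_surj (u : D) : exists x y, u = dual x y.
Proof.
exists (\val u)`_0, (\val u)`_1; apply: val_inj; rewrite val_dual.
have su : (size (\val u : {poly K}) <= 2)%N.
  by rewrite (leq_trans (size_npoly u)) // mk_monicX2 size_polyXn.
apply/polyP => -[|[|i]]; rewrite !coefE /= ?mulr0 ?mulr1 ?addr0 ?add0r //.
by rewrite nth_default // (leq_trans su).
Qed.

Lemma eta2 : Defs.eta k * Defs.eta k = 0.
Proof.
rewrite /Defs.eta -in_qpolyM; apply: val_inj => /=.
by rewrite mk_monicX2 -expr2 Pdiv.RingMonic.rmodpp ?monicXn.
Qed.

Lemma dual_10 : dual 1 0 = 1.
Proof. by rewrite -dualE scale0r addr0 scale1r. Qed.
Lemma dual00 : dual 0 0 = 0.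
Proof. by rewrite -dualE !scale0r addr0. Qed.
Lemma dualD x y x' y' : dual x y + dual x' y' = dual (x + x') (y + y').
Proof. by rewrite -!dualE addrACA -!scalerDl. Qed.
Lemma dualN x y : - dual x y = dual (- x) (- y).
Proof. by rewrite -!dualE opprD -!scaleNr. Qed.
Lemma dualZ c x y : c *: dual x y = dual (c * x) (c * y).
Proof. by rewrite -!dualE scalerDr !scalerA. Qed.
Lemma dualM x y x' y' : dual x y * dual x' y' = dual (x * x') (x * y' + y * x').
Proof.
rewrite -!dualE mulrDl !mulrDr -!scalerAl -!scalerAr eta2 !scaler0 addr0.
by rewrite !mul1r mulr1 !scalerA -addrA -scalerDl.
Qed.

(** Taylor expansion stops at first order because eta^2 = 0. This derivative is the source of the
    terms in F. *)
Lemma eval_dual x y a : eval (dual x y) a = dual (ev x a) (y * ev x a^`()).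
Proof.
have evalE u b : eval u b = (map_poly (GRing.in_alg D \o @ratC k) b).[u] by [].
elim/poly_ind: a => [|a c IH].
  by rewrite evalE !rmorph0 horner0 /= linear0 rmorph0 mulr0 dual00.
rewrite evalE rmorphD rmorphM /= map_polyX map_polyC hornerMXaddC -evalE IH /=.
have -> : (ratC c)%:A = dual (ratC c) 0 by rewrite -dualE scale0r addr0.
rewrite dualM dualD ev_cons derivMXaddC rmorphD rmorphM /= evX; congr dual.
  by rewrite mulrC.
by rewrite addr0 mulrDr mulrA [ev x a * y]mulrC.
Qed.

End DualNumbers.

Section Restrictions.
Variables (k : closedFieldType) (g : nat) (F : 'rV[k]_(g - 2)).
Local Notation K := (ratfun k).
Local Notation D := (generic_stalk k).
Local Notation t := (tvar k).

Lemma sinvE : sinv F = dual t (tail F).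
Proof. exact: dualE. Qed.

Lemma sinv_mulV : sinv F * dual t^-1 (- (t ^- 2 * tail F)) = 1.
Proof.
rewrite sinvE dualM divff ?tvar_neq0 // -dual_10; congr dual.
rewrite mulrN expr2 invfM -mulrA mulVKf ?tvar_neq0 //.
by rewrite mulrC addNr.
Qed.

Lemma sinvV : (sinv F)^-1 = dual t^-1 (- (t ^- 2 * tail F)).
Proof. exact: mulr1_eq sinv_mulV. Qed.

Lemma res1E f : res1 F f = dual (ev t^-1 f.1)
  (t ^- g.+1 * ev t^-1 f.2 - t ^- 2 * tail F * ev t^-1 f.1^`()).
Proof.
rewrite /res1 sinvV !eval_dual.
have -> : eps k g = dual 0 (t ^- g.+1) by rewrite -dualE scale0r add0r.
by rewrite dualM dualD !mulr0 !addr0 mulNr addrC [t ^- g.+1 * _]mulrC.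
Qed.

Lemma res2E f : res2 f = dual (ev t f.1) (ev t f.2).
Proof.
have tE : t%:A = dual t 0 by rewrite -dualE scale0r addr0.
have -> : res2 f = eval (dual t 0) f.1 + eval (dual t 0) f.2 * dual 0 1.
  by rewrite -tE -dualE scale0r add0r scale1r.
by rewrite !eval_dual dualM dualD !mul0r !mulr0 !addr0 add0r mulr1.
Qed.

Lemma overlap_dual (x y : K) : overlap (dual x y) <-> laurent x /\ laurent y.
Proof.
split=> [[[a b] [N]]|[/laurentP[N [a ->]] /laurentP[M [b ->]]]].
  rewrite res2E dualZ => /dual_inj[-> ->].
  by split; apply/laurentP; exists N; eexists.
exists ('X^M * a, 'X^N * b), (N + M)%N.
rewrite res2E dualZ !rmorphM /= !evXn exprD invfM; congr dual.
  by rewrite -mulrA [t ^- M * _]mulKf ?tvarX_neq0.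
by rewrite [t ^- N * _]mulrC -mulrA [t ^- N * _]mulKf ?tvarX_neq0.
Qed.

End Restrictions.

(** * Euler characteristic and degree *)

Section Cohomology.
Variables (k : closedFieldType) (g : nat) (F : 'rV[k]_(g - 2)).
Local Notation K := (ratfun k).
Local Notation D := (generic_stalk k).
Local Notation t := (tvar k).
Local Notation W := ({poly k} * {poly k})%type.

Lemma laurent_tail m (v : 'rV[k]_m) : laurent (tail v).
Proof.
rewrite /tail; elim/big_ind: _ => [||i _].
- by exists 0; rewrite ?raddf0.
- exact: laurentD.
- by apply: laurentZ; rewrite -[_ ^- _]mulr1; apply/laurent_tvarXVM/laurent1.
Qed.

Section Maps.
Variables (U0 U1 : K) (T1 T2 R : {linear W -> W}).
Hypothesis T1E : forall v, laurent_of (T1 v) = U0 * ev t^-1 v.1 - ev t v.2.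
Hypothesis T2E :
  forall v, laurent_of (T2 v) = (t ^- g.+1 * U0) * ev t^-1 v.1 - ev t v.2.
Hypothesis RE : forall v, laurent_of (R v) =
  ev t^-1 v.1 * U1 - t ^- 2 * tail F * ev t^-1 v.1^`() * U0.

(** [triangular] groups cochains by nilpotent order (reduced parts on both charts, then nilpotent
    parts), the Cech complex of the ribbon by chart. *)
Definition swap_cochains (v : W * W) : W * W := ((v.1.1, v.2.1), (v.1.2, v.2.2)).

Lemma coboundary_triangular v :
  res1 F (swap_cochains v).1 * dual U0 U1 - res2 (swap_cochains v).2 =
  dual (laurent_of (triangular T1 T2 R v).1) (laurent_of (triangular T1 T2 R v).2).
Proof.
rewrite res1E res2E /= dualM dualN dualD raddfD /= T1E T2E RE.
congr dual; first by rewrite [U0 * _]mulrC.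
by rewrite mulrBl [t ^- g.+1 * _ * _]mulrAC [_ * U0 - _]addrC !addrA.
Qed.

Lemma triangular_cohomology p1 q1 p2 q2 (x : 'I_p1 -> W) (z : 'I_p2 -> W)
    (y : 'I_q1 -> W) (w : 'I_q2 -> W) (M : 'M[k]_(p1, q2)) :
    ker_basis T1 x -> ker_basis T2 z -> coker_basis T1 y -> coker_basis T2 w ->
    (forall i, exists v, R (x i) = lincomb w (row i M) + T2 v) ->
  h0 F (dual U0 U1) (p2 + (p1 - \rank M)) /\ h1 F (dual U0 U1) (q1 + (q2 - \rank M)).
Proof.
move=> kerx kerz cokery cokerw connecting; split.
  apply: (quot_dim_image (phi := swap_cochains))
    (triangular_ker kerx kerz cokerw connecting).
  - by [].
  - by [].
  - move=> v /= vK; apply/eqP; rewrite /= -subr_eq0 coboundary_triangular vK /=.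
    by rewrite raddf0 dual00.
  - move=> [[a b] [a' b']] /= Sf; exists ((a, a'), (b, b')) => //=.
    move/eqP: Sf; rewrite -subr_eq0.
    rewrite -[_ - _]/(res1 F (swap_cochains ((a, a'), (b, b'))).1 * dual U0 U1
      - res2 (swap_cochains ((a, a'), (b, b'))).2).
    rewrite coboundary_triangular -dual00 => /eqP/dual_inj[].
    rewrite -(raddf0 (@laurent_of k)) => /laurent_of_inj T0 /laurent_of_inj T0'.
    by rewrite [LHS]surjective_pairing T0 T0'.
  - by move=> [[a b] [a' b']]; split=> [[-> -> -> ->]|[-> -> -> ->]].
pose phi (v : W * W) := dual (laurent_of v.1) (laurent_of v.2).
apply: (quot_dim_image (phi := phi))
  (triangular_coker kerx cokery cokerw connecting).
- by move=> u v /=; rewrite /phi dualD !raddfD.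
- by move=> c u /=; rewrite /phi dualZ !laurent_ofZ.
- by move=> v _; apply/overlap_dual; split; [exists v.1|exists v.2].
- move=> u; have [u0 [u1 ->]] := dual_surj u.
  by move=> /overlap_dual[[w0 _ <-] [w1 _ <-]]; exists (w0, w1).
- move=> u; split=> [[[[a b] [a' b']] uE]|[v _ <-]]; last first.
    by exists (swap_cochains v); rewrite coboundary_triangular.
  exists ((a, a'), (b, b')) => //.
  have := coboundary_triangular ((a, a'), (b, b')).
  rewrite -[swap_cochains _]/((a, b), (a', b')) -uE.
  move=> /dual_inj[/laurent_of_inj u0 /laurent_of_inj u1].
  by rewrite [LHS]surjective_pairing [RHS]surjective_pairing u0 u1.
Qed.

End Maps.

Lemma gluing_maps (U0 U1 : K) : laurent U0 -> laurent U1 ->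
  exists T1 T2 R : {linear W -> W}, [/\
    forall v, laurent_of (T1 v) = U0 * ev t^-1 v.1 - ev t v.2,
    forall v, laurent_of (T2 v) = (t ^- g.+1 * U0) * ev t^-1 v.1 - ev t v.2 &
    forall v, laurent_of (R v) =
      ev t^-1 v.1 * U1 - t ^- 2 * tail F * ev t^-1 v.1^`() * U0].
Proof.
move=> L0 L1.
have Lgl V : laurent V ->
    exists T : {linear W -> W},
      forall v, laurent_of (T v) = V * ev t^-1 v.1 - ev t v.2.
  move=> LV; apply: laurent_lift => [c u v|v].
    rewrite !rmorphD /= !evZ mulrDr opprD mulrBr addrACA.
    by rewrite mulrCA.
  by rewrite mulrC -[ev t _]mulr1; apply: laurentB;
    [apply: laurent_evV|apply/laurent_ev/laurent1].
have [T1 T1E] := Lgl _ L0; have [T2 T2E] := Lgl _ (laurent_tvarXVM g.+1 L0).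
have [R RE] : exists R : {linear W -> W}, forall v, laurent_of (R v) =
    ev t^-1 v.1 * U1 - t ^- 2 * tail F * ev t^-1 v.1^`() * U0.
  apply: laurent_lift => [c u v|v].
    rewrite derivD derivZ !rmorphD /= !evZ mulrBr !mulrDl mulrDr mulrDl opprD.
    by rewrite addrACA !mulrA [_ * _ * ratC c]mulrC !mulrA.
  apply: laurentB; first exact: laurent_evV.
  rewrite -!mulrA; apply: laurent_tvarXVM; apply: laurentM; first exact: laurent_tail.
  exact: laurent_evV.
by exists T1, T2, R.
Qed.

(** U = c t^(m-1) glues O(m-1), so the last equation reads chi(O(m-1)) = m. *)
Lemma gluing_bases (U : K) (T : {linear W -> W}) (c : k) (m : int) :
    (forall v, laurent_of (T v) = U * ev t^-1 v.1 - ev t v.2) ->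
    c != 0 -> t * U = ratC c * t ^ m ->
  exists p q (x : 'I_p -> W) (y : 'I_q -> W),
    [/\ ker_basis T x, coker_basis T y & p%:Z - q%:Z = m].
Proof.
move=> TE c0; case: m => [p|q] Um.
  have [kerx cokerx] := monomial_sections_basis TE c0 Um.
  by exists p, 0; do 2!eexists; split; [exact: kerx|exact: cokerx|rewrite subr0].
have [kerx cokerx] := monomial_classes_basis TE c0 Um.
by exists 0, q.+1; do 2!eexists; split;
  [exact: kerx|exact: cokerx|rewrite sub0r NegzE].
Qed.

(** Sum of chi(O(m)) and chi(O(m-g-1)): the rank of the connecting map lowers h^0 and h^1 equally
    and cancels. *)
Lemma euler_char_dual (c : k) (m : int) (U1 : K) : c != 0 -> laurent U1 ->
  euler_char F (dual (ratC c * t ^ m) U1) (m + 1 + (m - g%:Z)).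
Proof.
move=> c0 L1.
have L0 := laurent_monomial c m.
have [T1 [T2 [R [T1E T2E RE]]]] := gluing_maps L0 L1.
have t0 := tvar_neq0 k.
have U0 : t * (ratC c * t ^ m) = ratC c * t ^ (m + 1).
  by rewrite mulrCA expfzDr // expr1z [t * _]mulrC.
have UV : t * (t ^- g.+1 * (ratC c * t ^ m)) = ratC c * t ^ (m - g%:Z).
  rewrite exprS invfM -mulrA mulVKf ?t0 // (mulrCA _ (ratC c)) mulrC.
  by rewrite expfzDr ?t0 // exprnN mulrC [t ^ m * _]mulrC.
have [p1 [q1 [x [y [kerx cokery <-]]]]] := gluing_bases T1E c0 U0.
have [p2 [q2 [z [w [kerz cokerw <-]]]]] := gluing_bases T2E c0 UV.
have [M connecting] : {M : 'M[k]_(p1, q2) &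
    forall i, exists v, R (x i) = lincomb w (row i M) + T2 v}.
  have [a aE] := choice (fun i => cokerw.2 (R (x i))).
  by exists (\matrix_i a i) => i; rewrite rowK.
have [H0 H1] :=
  triangular_cohomology T1E T2E RE kerx kerz cokery cokerw connecting.
exists (p2 + (p1 - \rank M))%N, (q1 + (q2 - \rank M))%N; split=> //.
(* The rank is at most p1 and q2, so neither natural subtraction truncates. *)
by have := rank_leq_row M; have := rank_leq_col M; lia.
Qed.

Lemma h0_uniq u d d' : h0 F u d -> h0 F u d' -> d = d'.
Proof.
apply: quot_dim_uniq => //.
- by move=> c v w; rewrite scalerBr.
- by move=> c c' v; rewrite scalerDl.
- by move=> c c' v; rewrite scalerA.
- by move=> c v /= ->; rewrite scaler0.
- by move=> v w /= -> ->; rewrite addr0.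
Qed.

Lemma res1_linear c f f' : res1 F (c *: f + f') = ratC c *: res1 F f + res1 F f'.
Proof.
rewrite !res1E dualZ dualD /= !derivD !derivZ !rmorphD /= !evZ; congr dual.
by rewrite [in RHS]mulrBr !mulrDr opprD addrACA !(mulrCA _ (ratC c)).
Qed.

Lemma res2_linear c (f f' : {poly k} * {poly k}) :
  res2 (c *: f + f') = ratC c *: res2 f + res2 f'.
Proof. by rewrite !res2E dualZ dualD /= !rmorphD /= !evZ. Qed.

Lemma h1_uniq u d d' : h1 F u d -> h1 F u d' -> d = d'.
Proof.
have lin c x y : coboundaries F u x -> coboundaries F u y ->
    coboundaries F u (ratC c *: x + y).
  move=> [f ->] [f' ->]; exists (c *: f + f').
  by rewrite /= res1_linear res2_linear [(_ *: _ + _) * u]mulrDl -scalerAl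
    [in LHS]scalerBr [in RHS]opprD [RHS]addrACA.
have B0 : coboundaries F u 0.
  exists 0; rewrite res1E res2E /= !derivC !rmorph0 !mulr0 subrr dual00.
  by rewrite mul0r subrr.
apply: quot_dim_uniq => //.
- by move=> c v w; rewrite scalerBr.
- by move=> c c' v; rewrite rmorphD scalerDl.
- by move=> c c' v; rewrite rmorphM scalerA.
- by move=> c x Bx; rewrite -[_ *: _]addr0; apply: lin.
- by move=> x y Bx By; rewrite -[x]scale1r -[1](rmorph1 (@ratC k)); apply: lin.
Qed.

Lemma euler_char_uniq u d d' : euler_char F u d -> euler_char F u d' -> d = d'.
Proof.
move=> [a [b [Ha Hb ->]]] [a' [b' [Ha' Hb' ->]]].
by rewrite (h0_uniq Ha Ha') (h1_uniq Hb Hb').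
Qed.

(** The structure sheaf is the case m = 0, U1 = 0, with chi = 1 - g; subtracting it from 2m + 1 - g
    leaves 2m. *)
Lemma degree_dual (c : k) (m d : int) (U1 : K) : c != 0 -> laurent U1 ->
  degree F (dual (ratC c * t ^ m) U1) d <-> d = m + m.
Proof.
move=> c0 L1; have L0 : laurent (0 : K) by exists 0; rewrite ?raddf0.
have chiL := euler_char_dual m c0 L1.
have := euler_char_dual 0 (oner_neq0 k) L0.
rewrite rmorph1 expr0z mulr1 dual_10 => chiO; split=> [[a [b [Ha Hb ->]]]|->].
  rewrite (euler_char_uniq Ha chiL) (euler_char_uniq Hb chiO); lia.
by do 2!eexists; split; [exact: chiL|exact: chiO|lia].
Qed.

End Cohomology.

(** * Isomorphism classes *)

Section Isomorphisms.
Variables (k : closedFieldType) (g : nat) (F : 'rV[k]_(g - 2)).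
Local Notation K := (ratfun k).
Local Notation D := (generic_stalk k).
Local Notation t := (tvar k).
Local Notation W := ({poly k} * {poly k})%type.

Lemma ev_tvarV_inj : injective (ev t^-1).
Proof.
move=> a b ab; have [] // : (0, a) = (0, b) :> W.
by apply: laurent_of_inj; rewrite /laurent_of /= ab.
Qed.

Lemma res1_inj : injective (res1 F).
Proof.
move=> [a b] [a' b']; rewrite !res1E => /dual_inj[/= /ev_tvarV_inj->].
by move=> /addIr/(mulfI (invr_neq0 (tvarX_neq0 k _)))/ev_tvarV_inj->.
Qed.

Lemma res2_inj : injective (@res2 k).
Proof.
move=> [a b] [a' b'].
by rewrite !res2E => /dual_inj[/= /ev_tvar_inj-> /ev_tvar_inj->].
Qed.

(* The product of k[s,eps]/eps^2 and of k[t,eta]/eta^2 on pairs. *)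
Definition pmul (f f' : W) : W := (f.1 * f'.1, f.1 * f'.2 + f.2 * f'.1).

Lemma pmul_linearl c f f' h : pmul (c *: f + f') h = c *: pmul f h + pmul f' h.
Proof.
congr (_, _); rewrite /= !mulrDl -!scalerAl //.
by rewrite scalerDr addrACA.
Qed.

Lemma res1M f f' : res1 F (pmul f f') = res1 F f * res1 F f'.
Proof.
rewrite !res1E dualM /= derivM !rmorphD !rmorphM /=; congr dual.
have id (A : comPzRingType) (e s a b da a' b' da' : A) :
    e * (a * b' + b * a') - s * (da * a' + a * da') =
    a * (e * b' - s * da') + (e * b - s * da) * a' by ring.
exact: id.
Qed.

Lemma res2M (f f' : W) : res2 (pmul f f') = res2 f * res2 f'.
Proof. by rewrite !res2E dualM /= !rmorphD !rmorphM. Qed.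

Lemma res1_one : res1 F (1, 0) = 1.
Proof. by rewrite res1E /= derivC !rmorph0 rmorph1 !mulr0 subrr dual_10. Qed.

Lemma res2_one : res2 (1, 0) = 1 :> D.
Proof. by rewrite res2E /= rmorph0 rmorph1 dual_10. Qed.

Lemma unit1M f f' : unit1 F f -> unit1 F f' -> unit1 F (pmul f f').
Proof.
by move=> [h fh] [h' fh']; exists (pmul h h'); rewrite !res1M mulrACA fh fh' mulr1.
Qed.

Lemma unit2M (f f' : W) : unit2 f -> unit2 f' -> unit2 (pmul f f').
Proof.
by move=> [h fh] [h' fh']; exists (pmul h h'); rewrite !res2M mulrACA fh fh' mulr1.
Qed.

Lemma iso_refl u : iso F u u.
Proof.
exists (1, 0), (1, 0); rewrite res1_one res2_one mulr1 mul1r.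
by split=> //; exists (1, 0); rewrite ?res1_one ?res2_one mulr1.
Qed.

Lemma iso_sym u u' : iso F u u' -> iso F u' u.
Proof.
move=> [v1 [v2 [[w1 vw1] [w2 vw2] uu']]]; exists w1, w2.
split; [by exists v1; rewrite mulrC|by exists v2; rewrite mulrC|].
by rewrite -[u in LHS]mul1r -vw1 -[u' in RHS]mulr1 -vw2 [u' * _]mulrA uu';
  rewrite -!mulrA mulrCA.
Qed.

Lemma iso_trans u u' u'' : iso F u u' -> iso F u' u'' -> iso F u u''.
Proof.
move=> [v1 [v2 [U1 U2 uu']]] [w1 [w2 [U1' U2' uu'']]].
exists (pmul w1 v1), (pmul w2 v2); split; [exact: unit1M|exact: unit2M|].
by rewrite res1M res2M mulrA uu'' -mulrA uu' mulrA.
Qed.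

Lemma iso_class_eq u u' : iso F u u' -> iso_class F u = iso_class F u'.
Proof.
move=> uu'; apply/seteqP; split=> v [Lv] uv; split=> //.
  exact: iso_trans (iso_sym uu') uv.
exact: iso_trans uu' uv.
Qed.

(** With new generators v_i e_i, the section f_i e_i acquires the coordinates f_i w_i, where w_i
    inverts v_i. *)
Lemma h0_iso u u' d : iso F u u' -> h0 F u d -> h0 F u' d.
Proof.
move=> [v1 [v2 [[w1 vw1] [w2 vw2] uu']]].
have vwK1 f : pmul (pmul f v1) w1 = f.
  by apply: res1_inj; rewrite !res1M -mulrA vw1 mulr1.
have wvK1 f : pmul (pmul f w1) v1 = f.
  by apply: res1_inj; rewrite !res1M -mulrA (mulrC _ (res1 F v1)) vw1 mulr1.
have vwK2 (f : W) : pmul (pmul f v2) w2 = f.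
  by apply: res2_inj; rewrite !res2M -mulrA vw2 mulr1.
have wvK2 (f : W) : pmul (pmul f w2) v2 = f.
  by apply: res2_inj; rewrite !res2M -mulrA (mulrC _ (res2 v2)) vw2 mulr1.
have pmul0 h : pmul 0 h = 0 by rewrite /pmul !mul0r addr0.
pose phi (f : W * W) := (pmul f.1 w1, pmul f.2 w2).
have philin c f f' : phi (c *: f + f') = c *: phi f + phi f'.
  by rewrite /phi /= !pmul_linearl.
have phi0 : phi 0 = 0 by rewrite /phi /= !pmul0.
apply: (quot_dim_image (phi := phi)).
- by move=> f f'; rewrite -[f in LHS]scale1r philin scale1r.
- by move=> c f /=; rewrite -[_ *: _ in LHS]addr0 philin phi0 addr0.
- move=> f Sf; have {}Sf : res1 F f.1 * u = res2 f.2 := Sf.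
  suff : res1 F (pmul f.1 w1) * u' = res2 (pmul f.2 w2) by [].
  rewrite res1M res2M -Sf -[u']mulr1 -vw2 [u' * _]mulrA uu' -!mulrA.
  by congr (_ * _); rewrite mulrA (mulrC (res1 F w1)) vw1 mul1r.
- move=> f Sf; have {}Sf : res1 F f.1 * u' = res2 f.2 := Sf.
  exists (pmul f.1 v1, pmul f.2 v2); last first.
    by rewrite [f in LHS]surjective_pairing /phi vwK1 vwK2.
  suff : res1 F (pmul f.1 v1) * u = res2 (pmul f.2 v2) by [].
  by rewrite res1M res2M -mulrA -uu' mulrA Sf.
- move=> [f1 f2]; split=> [f0|/= ->]; last exact: phi0.
  have f10 : pmul f1 w1 = 0 := congr1 fst f0.
  have f20 : pmul f2 w2 = 0 := congr1 snd f0.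
  by rewrite -[f1]wvK1 -[f2]wvK2 f10 f20 !pmul0.
Qed.

Lemma pmul_constV (c : k) b :
  c != 0 -> pmul (c%:P, b) (c^-1%:P, - (c ^- 2 *: b)) = (1, 0).
Proof.
move=> c0; rewrite /pmul /= -polyCM divff //; congr (_, _).
rewrite mulrN mul_polyC scalerA expr2 invfM mulrA divff // mul1r.
by rewrite [b * _]mulrC mul_polyC addNr.
Qed.

Lemma unit1_const (c : k) b : c != 0 -> unit1 F (c%:P, b).
Proof.
move=> c0; exists (c^-1%:P, - (c ^- 2 *: b)).
by rewrite -res1M -res1_one pmul_constV.
Qed.

Lemma unit2_const (c : k) b : c != 0 -> unit2 (c%:P, b).
Proof.
move=> c0; exists (c^-1%:P, - (c ^- 2 *: b)).
by rewrite -res2M -res2_one pmul_constV.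
Qed.

Lemma poly_mul1_const (a b : {poly k}) : a * b = 1 -> exists2 c, c != 0 & a = c%:P.
Proof.
move=> ab; apply/size_poly1P.
have : a \is a GRing.unit by apply/unitrP; exists b; rewrite mulrC ab.
by rewrite poly_unitE => /andP[].
Qed.

Lemma res1_const (c : k) b :
  res1 F (c%:P, b) = dual (ratC c) (t ^- g.+1 * ev t^-1 b).
Proof. by rewrite res1E /= derivC rmorph0 mulr0 subr0 evC. Qed.

Lemma res2_const (c : k) b : res2 (c%:P, b) = dual (ratC c) (ev t b).
Proof. by rewrite res2E /= evC. Qed.

(** The reduced part is a unit of k[s], hence constant; its derivative vanishes, so no F enters the
    restriction of a unit ([res1_const]). *)
Lemma unit1P f : unit1 F f -> exists2 c, c != 0 & f = (c%:P, f.2).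
Proof.
case: f => a b [f'].
rewrite -res1M -res1_one => /res1_inj[/poly_mul1_const[c c0 ->] _].
by exists c.
Qed.

Lemma unit2P (f : W) : unit2 f -> exists2 c, c != 0 & f = (c%:P, f.2).
Proof.
case: f => a b [f'].
rewrite -res2M -res2_one => /res2_inj[/poly_mul1_const[c c0 ->] _].
by exists c.
Qed.

Lemma line_bundle_dual (c : k) m U1 : c != 0 -> laurent U1 ->
  line_bundle (dual (ratC c * t ^ m) U1).
Proof.
move=> c0 L1.
have Lt := @laurent_monomial k.
have tV : ratC c * t ^ m * (ratC c^-1 * t ^ (- m)) = 1.
  rewrite mulrACA -rmorphM -expfzDr ?tvar_neq0 //.
  by rewrite (divff c0) subrr expr0z mulr1 rmorph1.
split; first by apply/overlap_dual.
exists (dual (ratC c^-1 * t ^ (- m))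
  (- (ratC c^-1 * t ^ (- m) * (ratC c^-1 * t ^ (- m) * U1)))).
  apply/overlap_dual; split; first exact: Lt.
  by apply: laurentN; apply: laurentM (Lt _ _) _; apply: laurentM (Lt _ _) L1.
rewrite dualM tV -dual_10; congr dual.
by rewrite mulrN (mulrA (ratC c * t ^ m)) tV mul1r [U1 * _]mulrC addNr.
Qed.

(** The reduced part is a unit of k[t,t^-1]. Clearing denominators, its numerator divides a power of
    X, hence is a monomial up to a scalar. *)
Lemma line_bundleP (u : D) : line_bundle u ->
  exists c m U1, [/\ c != 0, laurent U1 & u = dual (ratC c * t ^ m) U1].
Proof.
have [a [U1 ->]] := dual_surj u; case=> /overlap_dual[La L1] [w].
have [b [W1 ->]] := dual_surj w; move=> /overlap_dual[Lb _].
rewrite dualM -dual_10 => /dual_inj[ab _].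
move/laurentP: La ab => [N [p ->]]; move/laurentP: Lb => [M [q ->]] pq.
have {}pq : p * q = 'X^(N + M).
  apply: ev_tvar_inj; rewrite rmorphM /= evXn exprD.
  rewrite -[RHS]mulr1 -pq -!mulrA (mulrCA (t ^+ M)) mulVKf ?tvarX_neq0 //.
  by rewrite [t ^+ M * _]mulrCA mulVKf ?tvarX_neq0.
have /dvdp_exp_XsubCP[j _ /eqpP[[c1 c2] /= /andP[c10 c20] pE]] :
    p %| ('X - 0%:P) ^+ (N + M) by rewrite subr0 -pq dvdp_mulr.
exists (c1^-1 * c2), (j%:Z - N%:Z), U1; split=> //.
  by rewrite mulf_neq0 ?invr_neq0.
congr dual; have -> : p = (c1^-1 * c2) *: 'X^j.
  by rewrite -scalerA -[X in c2 *: X ^+ j]subr0 -pE scalerA mulVf // scale1r.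
rewrite evZ evXn mulrCA expfzDr ?tvar_neq0 // exprnN; congr (_ * _).
exact: mulrC.
Qed.

End Isomorphisms.

(** * Bundles with gluing datum G: classification in degree 2n, and their h^0 *)

Section StandardBundles.
Variables (k : closedFieldType) (g n : nat) (F : 'rV[k]_(g - 2)).
Local Notation K := (ratfun k).
Local Notation D := (generic_stalk k).
Local Notation t := (tvar k).
Local Notation W := ({poly k} * {poly k})%type.

(** The multiplicity m makes both sides zero at m = 0, where the truncated predecessor would
    otherwise give the wrong exponent. *)
Lemma exprpred (A : fieldType) (x : A) m :
  x != 0 -> x ^+ m.-1 *+ m = (x^-1 * x ^+ m) *+ m.
Proof. by move=> x0; case: m => // m; rewrite exprS mulKf. Qed.

Lemma coef_rVpoly_coef1 m (v : 'rV[k]_m) l : (rVpoly v)`_l = Defs.coef1 v l.+1.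
Proof.
rewrite -lincomb_polyX coef_sum /Defs.coef1 [RHS]big_mkcond.
apply: eq_bigr => j _; rewrite coefZ coefXn eqSS eq_sym.
by case: eqP; rewrite ?mulr1 ?mulr0.
Qed.

Lemma tail_laurent m (v : 'rV[k]_m) : tail v = laurent_of (0, rVpoly v).
Proof.
rewrite /laurent_of /= rmorph0 add0r -lincomb_polyX /lincomb rmorph_sum mulr_sumr.
apply: eq_bigr => j _; rewrite /= evZ evXn mulrCA; congr (_ * _).
by rewrite -exprS exprVn.
Qed.

Lemma tvarM_laurent_of p q :
  t * laurent_of (p, q) = laurent_of (p * 'X + (q`_0)%:P, drop_poly 1 q).
Proof.
rewrite /laurent_of /= {1}(poly_split 1 q) mulrDr ev_cons -addrA; congr (_ + _).
rewrite mulVKf ?tvar_neq0 // rmorphD rmorphM /= expr1 evX; congr (_ + _).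
rewrite poly_rV_K ?size_take_poly // (_ : take_poly 1 q = (q`_0)%:P) ?evC //.
by apply/polyP => -[|i]; rewrite coef_take_poly coefC.
Qed.

(** Multiplication by t^i shifts the index: t^-(l+1) gets coefficient v_(i+l+1). Hence the Hankel
    pattern G_(i+j-1) of the matrix. *)
Lemma shift_tail m (v : 'rV[k]_m) i : exists p q,
  t ^+ i * tail v = laurent_of (p, q) /\ forall l, q`_l = Defs.coef1 v (i + l).+1.
Proof.
elim: i => [|i [p [q [pqE qE]]]].
  exists 0, (rVpoly v); split; first by rewrite mul1r tail_laurent.
  exact: coef_rVpoly_coef1.
exists (p * 'X + (q`_0)%:P), (drop_poly 1 q); split=> [|l].
  by rewrite exprS -mulrA pqE tvarM_laurent_of.
by rewrite coef_drop_poly qE addn1 addnS addSn.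
Qed.

Lemma sinvX : sinv F ^+ n = dual (t ^+ n) (tail F * t ^+ n.-1 *+ n).
Proof.
elim: n => [|m IH]; first by rewrite mulr0n dual_10.
rewrite exprS IH sinvE dualM -exprS -!mulrnAr exprpred ?tvar_neq0 //; congr dual.
by rewrite (mulrCA t) (mulrnAr t) mulVKf ?tvar_neq0 // -mulrDr -mulrSr.
Qed.

Lemma one_plus_tail (G : 'rV[k]_g) : 1 + tail G *: Defs.eta k = dual 1 (tail G).
Proof. by rewrite -dualE scale1r. Qed.

Definition bundle_unit (G : 'rV[k]_g) : D := sinv F ^+ n * (1 + tail G *: Defs.eta k).

Lemma bundle_unitE G : bundle_unit G =
  dual (ratC 1 * t ^ n%:Z) (t ^+ n * tail G + tail F * t ^+ n.-1 *+ n).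
Proof. by rewrite /bundle_unit one_plus_tail sinvX dualM rmorph1 mul1r !mulr1. Qed.

Lemma laurent_bundle_unit (G : 'rV[k]_g) :
  laurent (t ^+ n * tail G + tail F * t ^+ n.-1 *+ n).
Proof.
apply: laurentD; first exact/laurent_tvarXM/laurent_tail.
rewrite -mulr_natl -(rmorph_nat (@ratC k)); apply: laurentZ.
by rewrite mulrC; exact/laurent_tvarXM/laurent_tail.
Qed.

Lemma line_bundle_unit G : line_bundle (bundle_unit G).
Proof.
rewrite bundle_unitE.
exact: line_bundle_dual (oner_neq0 _) (laurent_bundle_unit G).
Qed.

Lemma degree_bundle_unit G : degree F (bundle_unit G) (2 * n)%N%:Z.
Proof.
rewrite bundle_unitE; apply/degree_dual; first exact: oner_neq0.
  exact: laurent_bundle_unit.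
by lia.
Qed.

(** Once sinv^n is cancelled, units with equal constant c change c G only by elements of k[t] and
    t^(-g-1) k[t^-1], which cannot alter the coefficients of t^-1, ..., t^-g. *)
Lemma bundle_unit_inj G G' : iso F (bundle_unit G) (bundle_unit G') -> G = G'.
Proof.
move=> [v1 [v2 [/unit1P[c c0 ->] /unit2P[d d0 ->]]]].
have sinvU : sinv F \is a GRing.unit.
  apply/unitrP; exists (dual t^-1 (- (t ^- 2 * tail F))).
  by rewrite mulrC sinv_mulV.
rewrite /bundle_unit -mulrA (mulrCA (res1 _ _)) => /(mulrI (unitrX n sinvU)).
rewrite !one_plus_tail res1_const res2_const !dualM => /dual_inj[].
rewrite mul1r mulr1 => dc; rewrite dc mul1r mulr1 !tail_laurent.
set p := v2.2; set q := v1.2 => E.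
have : laurent_of (p, c *: rVpoly G') = laurent_of (0, c *: rVpoly G + 'X^g * q).
  move: E; rewrite /laurent_of /= !rmorph0 !add0r rmorphD rmorphM /= !evZ evXn.
  rewrite (mulrC _ (ratC c)) (mulrCA t^-1 (ratC c)) => ->.
  by rewrite mulrDr (mulrCA t^-1 (ratC c)) exprS invfM exprVn -mulrA.
move=> /laurent_of_inj[_ GE]; apply/eqP; rewrite eq_sym -subr_eq0.
have /eqP : c *: (G' - G) = 0.
  by apply: (@rVpoly_eq0 _ _ _ q); rewrite linearZ linearB /= scalerBr GE addrC addKr.
by rewrite scaler_eq0 (negPf c0).
Qed.

(** The degree fixes the exponent n; dividing by c sinv^n leaves 1 + x eta with x Laurent, and x is
    then truncated to the range t^-1, ..., t^-g. *)
Lemma line_bundle_degree u : line_bundle u -> degree F u (2 * n)%N%:Z ->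
  exists G, iso F u (bundle_unit G).
Proof.
move=> /line_bundleP[c [m [U1 [c0 L1 ->]]]] /degree_dual -/(_ c0 L1) mE.
have {mE} -> : m = n%:Z by lia.
have cK0 : ratC c != 0 by rewrite ratC_eq0.
(* The eta-coefficient of [sinv F ^+ n]. *)
pose B := tail F * t ^+ n.-1 *+ n.
have LB : laurent B.
  rewrite -[B]add0r -(mulr0 (t ^+ n)).
  have <- : tail (0 : 'rV[k]_g) = 0.
    by rewrite /tail big1 // => i _; rewrite mxE rmorph0 mul0r.
  exact: laurent_bundle_unit.
have [[p q] _ pqE] : laurent ((ratC c)^-1 * (t ^- n * (U1 - B * ratC c))).
  rewrite -fmorphV; apply: laurentZ; apply: laurent_tvarXVM; apply: laurentB => //.
  by rewrite mulrC; apply: laurentZ.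
exists (poly_rV (take_poly g q)); set G := poly_rV _; apply: iso_sym.
pose q' := drop_poly g q.
(* The unit on U_1 absorbs the terms from t^(-g-1) downwards, the unit on U_2 the polynomial part;
   the scalar c is put on U_1. *)
exists (c%:P, c *: q'), (1%:P, - p); split.
- exact: unit1_const.
- by apply: unit2_const; apply: oner_neq0.
rewrite res1_const res2_const /bundle_unit one_plus_tail.
have -> : dual (ratC c * t ^ n%:Z) U1 =
    sinv F ^+ n * dual (ratC c) (ratC c * laurent_of (p, q)).
  rewrite sinvX dualM pqE mulVKf // [t ^+ n * (_ * _)]mulVKf ?tvarX_neq0 //.
  by rewrite -/B subrK mulrC.
rewrite -mulrA [RHS]mulrCA !dualM rmorph1 !mulr1; congr (_ * dual _ _).
rewrite tail_laurent /laurent_of /= (poly_split g q) rmorph0 rmorphN.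
rewrite rmorphD rmorphM /= evXn evZ (mulrCA _ (ratC c)) -!mulrDr.
congr (_ * _).
by rewrite addKr add0r mulrDr exprS invfM exprVn -mulrA.
Qed.

Lemma bundle_of_bij :
  set_bij [set: 'rV[k]_g] (Pic F (2 * n)%N%:Z) (bundle_of F n).
Proof.
split.
- move=> G _; exists (bundle_unit G); split=> //.
    exact: line_bundle_unit.
  exact: degree_bundle_unit.
- move=> G G' _ _ GG'; apply: bundle_unit_inj.
  have : bundle_of F n G' (bundle_unit G').
    by split; [exact: line_bundle_unit|exact: iso_refl].
  by rewrite -GG' => -[].
- move=> L [u [Lu du ->]]; have [G uG] := line_bundle_degree Lu du.
  by exists G => //; rewrite (iso_class_eq uG).
Qed.

(** The value of the connecting map on s^(m-i): m copies of x^(i-1) b from the gluing datum minus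
    m-i from the derivative leave i. *)
Lemma connecting_monomial (A : fieldType) (x a b : A) i m :
    x != 0 -> (i <= m)%N ->
  x^-1 ^+ (m - i) * (x ^+ m * a + b * x ^+ m.-1 *+ m) -
    x ^- 2 * b * (x^-1 ^+ (m - i).-1 *+ (m - i)) * x ^+ m =
  x ^+ i * a + x^-1 * x ^+ i * b *+ i.
Proof.
move=> x0 /subnKC; move: (m - i)%N => j <-.
have xj0 : x ^+ j != 0 by rewrite expf_neq0.
rewrite -(mulrnAr b) !exprpred ?invr_neq0 // invrK exprVn exprD.
by field; rewrite x0.
Qed.

Lemma h0_bundle_unit (G : 'rV[k]_g) : (n <= g)%N ->
  h0 F (bundle_unit G) (n.+1 - \rank (AF n F G)).
Proof.
move=> le_ng; rewrite bundle_unitE rmorph1 mul1r.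
have L0 : laurent (t ^ n%:Z) by rewrite -[_ ^ _]mulr1; apply/laurent_tvarXM/laurent1.
have [T1 [T2 [R [T1E T2E RE]]]] := gluing_maps F L0 (laurent_bundle_unit G).
have U0 : t * t ^ n%:Z = ratC 1 * t ^+ n.+1 by rewrite rmorph1 mul1r exprS.
have UV : t * (t ^- g.+1 * t ^ n%:Z) = ratC 1 * t ^- (g - n).
  rewrite rmorph1 mul1r exprS invfM -mulrA mulVKf ?tvar_neq0 //.
  by rewrite exprB_tvar // invfM invrK.
have [kerx cokery] := monomial_sections_basis T1E (oner_neq0 k) U0.
have [kerz cokerw] := monomial_classes_basis T2E (oner_neq0 k) UV.
rewrite -mxrank_tr -[(n.+1 - _)%N]add0n.
suff connecting : forall i, exists v, R (monomial_sections 1 i) =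
    lincomb (@monomial_classes k (g - n)) (row i (AF n F G)^T) + T2 v.
  exact: (triangular_cohomology T1E T2E RE kerx kerz cokery cokerw connecting).1.
move=> i.
have [p [q [pqE qE]]] := shift_tail G i.
(* At i = 0 the factor i kills t^-1 F; otherwise t^(i-1) F is a shift by i-1, whence the index i +
   l. *)
have [p' [q' [pqE' qE']]] : exists p q,
    (t^-1 * t ^+ i * tail F) *+ i = laurent_of (p, q) /\
    forall l, q`_l = i%:R * Defs.coef1 F (i + l).
  case: {pqE qE} (val i) => [|j].
    by exists 0, 0; rewrite mulr0n raddf0; split=> // l; rewrite coef0 mul0r.
  have [a [b [abE bE]]] := shift_tail F j.
  exists (j.+1%:R *: a), (j.+1%:R *: b); split=> [|l].
    rewrite -[LHS]mulr_natl exprS mulKf ?tvar_neq0 // abE -(rmorph_nat (@ratC k)).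
    by rewrite -laurent_ofZ.
  by rewrite coefZ bE.
have RxE : R (monomial_sections 1 i) = (p + p', q + q').
  apply: laurent_of_inj; rewrite RE /= derivXn rmorphMn /= !evXn.
  have -> : laurent_of (p + p', q + q') = laurent_of (p, q) + laurent_of (p', q').
    by rewrite -raddfD.
  rewrite -pqE -pqE'.
  apply: connecting_monomial; first exact: tvar_neq0.
  by rewrite -ltnS.
(* Modulo the image of [T2] only t^-1, ..., t^-(g-n) survive: a column of the matrix. *)
exists (drop_poly (g - n) (q + q'), - (p + p')).
rewrite RxE (gluing_negE T2E UV) scale1r opprK.
rewrite /monomial_classes lincomb_pair lincomb0 lincomb_polyX.
rewrite -[RHS]/(_ + _, _ + _) add0r; congr (_, _).
rewrite {1}(poly_split (g - n) (q + q')); congr (rVpoly _ + _).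
apply/rowP => l; rewrite !mxE coef_take_poly ltn_ord coefD qE qE'.
by rewrite [(l + i)%N]addnC.
Qed.

End StandardBundles.

Theorem theorem2p2 (k : closedFieldType) (char0 : [pchar k] =i pred0)
    (g n r : nat) (g_ge1 : (1 <= g)%N) (n_le : (2 * n <= g - 1)%N)
    (F : 'rV[k]_(g - 2)) :
  set_bij [set: 'rV[k]_g] (Pic F (2 * n)%N%:Z) (bundle_of F n) /\
  bundle_of F n @^-1` W F r (2 * n)%N%:Z =
    [set G : 'rV[k]_g | ((\rank (AF n F G))%:Z <= n%:Z - r%:Z)%R].
Proof.
have le_ng : (n <= g)%N by lia.
split; first exact: bundle_of_bij.
apply/seteqP; split=> G /=.
  move=> [_ [u [h [[_ Gu] hu le_rh]]]].
  (* Membership only provides some isomorphic [u] and some dimension [h]; invariance and uniqueness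
     identify [h] with n + 1 minus the rank. *)
  have := h0_uniq (h0_iso (iso_sym Gu) hu) (h0_bundle_unit F G le_ng).
  by lia.
move=> rankG; split.
  exists (bundle_unit n F G); split=> //.
    exact: line_bundle_unit.
  exact: degree_bundle_unit.
exists (bundle_unit n F G), (n.+1 - \rank (AF n F G))%N; split.
- by split; [exact: line_bundle_unit|exact: iso_refl].
- exact: h0_bundle_unit.
- by lia.
Qed.
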